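(* Let $(\mathfrak{A}_q,[\cdot,\cdot]_q,\alpha_q)$ be the $q$-deformed Heisenberg-Virasoro superalgebra of Hom-type. If $\varphi$ is an even $q$-derivation of $\mathfrak{A}_q$ of degree $s\neq 0$, then it is an inner derivation; more precisely, $$(\mathcal{Q}\mathrm{Der}\,\mathfrak{A}_q)_{0,s}=\langle \mathrm{ad}_{L_s}+\mathrm{ad}_{I_s}\rangle,$$ where $(\mathcal{Q}\mathrm{Der}\,\mathfrak{A}_q)_{0,s}$ is the space of even $q$-derivations of degree $s$.
   Context: Let $q\in\mathbb{C}\setminus\{0,1\}$ and $\{n\}=\frac{1-q^n}{1-q}$ for $n\in\mathbb{Z}$. $\mathfrak{A}_q$ is the complex superspace with basis $\{L_m,I_m\mid m\in\mathbb{Z}\}$ of parity $0$ and $\{G_m,T_m\mid m\in\mathbb{Z}\}$ of parity $1$, with super-skew-symmetric bracket ($[x,y]_q=-(-1)^{|x||y|}[y,x]_q$) determined by $[L_m,L_n]_q=(\{m\}-\{n\})L_{m+n}$, $[L_m,I_n]_q=-\{n\}I_{m+n}$, $[L_m,G_n]_q=(\{m\}-\{n+1\})G_{m+n}$, $[I_m,G_n]_q=\{m\}T_{m+n}$, $[L_m,T_n]_q=-\{n+1\}T_{m+n}$, and $[I_m,I_n]_q=[I_m,T_n]_q=[T_m,G_n]_q=[T_m,T_n]_q=[G_m,G_n]_q=0$; the twist is the even linear map $\alpha_q(L_n)=(1+q^n)L_n$, $\alpha_q(I_n)=(1+q^n)I_n$, $\alpha_q(G_n)=(1+q^{n+1})G_n$,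 $\alpha_q(T_n)=(1+q^{n+1})T_n$. An even $q$-derivation of degree $s\in\mathbb{Z}$ is an even linear map $\varphi:\mathfrak{A}_q\to\mathfrak{A}_q$ that maps $\mathrm{span}(L_n,I_n)$ into $\mathrm{span}(L_{n+s},I_{n+s})$ and $\mathrm{span}(G_n,T_n)$ into $\mathrm{span}(G_{n+s},T_{n+s})$ for all $n$, and satisfies, for all homogeneous $x,y$, $$\varphi([x,y]_q)=\frac{1}{1+q^{s}}\Big([\varphi(x),\alpha_q(y)]_q+[\alpha_q(x),\varphi(y)]_q\Big).$$ For a homogeneous $a\in\mathfrak{A}_q$, $\mathrm{ad}_a$ is the map $x\mapsto[a,x]_q$, called an inner $q$-derivation. $\langle\cdot\rangle$ denotes linear span.
   Formalization: Assumes {s} ≠ 0, i.e. q^s ≠ 1 (if q^s = 1, L_n↦I_{n+s}, G_n↦T_{n+s}, I_n,T_n↦0 is a non-inner even q-derivation), and 1+q^s ≠ 0 so that the definition makes sense; ⟨ad_{L_s}+ad_{I_s}⟩ is read as the span of the two maps ad_{L_s}, ad_{I_s}. *)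

(* Defs.v *)
From HB Require Import structures.
From mathcomp Require Import all_boot all_order all_algebra finmap.
From mathcomp Require Import reals.
From mathcomp.real_closed Require Import complex.
From mathcomp.multinomials Require Import monalg.

Set Implicit Arguments.
Unset Strict Implicit.
Unset Printing Implicit Defensive.

Import GRing.Theory.
Local Open Scope ring_scope.

Inductive gen := gL of int | gI of int | gG of int | gT of int.

Definition gen_code (k : gen) : bool * bool * int :=
  match k with
  | gL n => (false, false, n)
  | gI n => (false, true, n)
  | gG n => (true, false, n)
  | gT n => (true, true, n)
  end.

Definition gen_decode (c : bool * bool * int) : gen :=
  match c with
  | (false, false, n) => gL n
  | (false, true, n) => gI n
  | (true, false, n) => gG n
  | (true, true, n) => gT n
  end.

Lemma gen_codeK : cancel gen_code gen_decode.
Proof. by case. Qed.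

HB.instance Definition _ := Choice.copy gen (can_type gen_codeK).

(* Parity of a basis element: true is the parity 1. *)
Definition gpar (k : gen) : bool :=
  match k with gL _ | gI _ => false | gG _ | gT _ => true end.

(* The vector space with basis gen: finitely supported functions gen -> F. *)
Notation hva F := {malg F[gen]}.

Section HeisenbergVirasoro.

Variables (F : fieldType) (q : F).

Definition qint (n : int) : F := (1 - q ^ n) / (1 - q).

Definition bL (n : int) : hva F := << gL n >>.
Definition bI (n : int) : hva F := << gI n >>.
Definition bG (n : int) : hva F := << gG n >>.
Definition bT (n : int) : hva F := << gT n >>.

Definition homog (p : bool) (x : hva F) : Prop :=
  forall k, k \in msupp x -> gpar k = p.

Definition gen_bracket (a b : gen) : hva F :=
  match a, b with
  | gL m, gL n => (qint m - qint n) *: bL (m + n)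
  | gL m, gI n => - qint n *: bI (m + n)
  | gI m, gL n => - (- qint m *: bI (n + m))
  | gL m, gG n => (qint m - qint (n + 1)) *: bG (m + n)
  | gG m, gL n => - ((qint n - qint (m + 1)) *: bG (n + m))
  | gI m, gG n => qint m *: bT (m + n)
  | gG m, gI n => - (qint n *: bT (n + m))
  | gL m, gT n => - qint (n + 1) *: bT (m + n)
  | gT m, gL n => - (- qint (m + 1) *: bT (n + m))
  | gI _, gI _ | gI _, gT _ | gT _, gI _ | gT _, gG _ | gG _, gT _
  | gT _, gT _ | gG _, gG _ => 0
  end.

Definition bracket (x y : hva F) : hva F :=
  \sum_(a <- msupp x) \sum_(b <- msupp y) (x@_a * y@_b) *: gen_bracket a b.

Definition gen_twist (k : gen) : F :=
  match k with
  | gL n | gI n => 1 + q ^ n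
  | gG n | gT n => 1 + q ^ (n + 1)
  end.

Definition twist (x : hva F) : hva F :=
  \sum_(k <- msupp x) (x@_k * gen_twist k) *: << k >>.

Definition ad (a : hva F) : hva F -> hva F := bracket a.

Definition in_span2 (u v x : hva F) : Prop :=
  exists c d : F, x = c *: u + d *: v.

(* Meaningful only when 1 + q ^ s is nonzero. *)
Record even_qder (s : int) (phi : {linear hva F -> hva F}) : Prop := EvenQDer {
  even_qder_even : forall p x, homog p x -> homog p (phi x);
  even_qder_deg0 : forall n x,
    in_span2 (bL n) (bI n) x -> in_span2 (bL (n + s)) (bI (n + s)) (phi x);
  even_qder_deg1 : forall n x,
    in_span2 (bG n) (bT n) x -> in_span2 (bG (n + s)) (bT (n + s)) (phi x);
  even_qder_leibniz : forall p r x y, homog p x -> homog r y ->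
    phi (bracket x y) =
      (1 + q ^ s)^-1 *:
        (bracket (phi x) (twist y) + bracket (twist x) (phi y))
}.

Definition inner_qder (phi : {linear hva F -> hva F}) : Prop :=
  exists (p : bool) (a : hva F), homog p a /\ phi =1 ad a.

Lemma bracketw (X Y : {fset gen}) (x y : hva F) :
  (msupp x `<=` X)%fset -> (msupp y `<=` Y)%fset ->
  bracket x y =
    \sum_(a <- X) \sum_(b <- Y) (x@_a * y@_b) *: gen_bracket a b.
Proof.
move=> sX sY; rewrite /bracket (big_fset_incl _ sX) /=; last first.
  move=> a _ /mcoeff_outdom ->; rewrite big1 // => b _.
  by rewrite mul0r scale0r.
apply: eq_bigr => a _; apply: big_fset_incl => //= b _ /mcoeff_outdom ->.
by rewrite mulr0 scale0r.
Qed.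

Lemma bracket_gen (a b : gen) : bracket << a >> << b >> = gen_bracket a b.
Proof.
rewrite (bracketw (msuppU_le (x := 1)) (msuppU_le (x := 1))).
by rewrite !big_seq_fset1 !mcoeffUU mulr1 scale1r.
Qed.

Lemma gen_bracket_skew (a b : gen) :
  gen_bracket a b = - ((-1) ^+ (gpar a && gpar b) *: gen_bracket b a).
Proof.
case: a b => [m|m|m|m] [n|n|n|n] /=; rewrite ?scaler0 ?oppr0 ?scale1r ?opprK //.
by rewrite -scaleNr opprB [n + m]addrC.
Qed.

Lemma bracket_skew (p r : bool) (x y : hva F) : homog p x -> homog r y ->
  bracket x y = - ((-1) ^+ (p && r) *: bracket y x).
Proof.
move=> hx hy; rewrite /bracket exchange_big /= scaler_sumr -sumrN.
apply: eq_big_seq => b hb; rewrite scaler_sumr -sumrN.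
apply: eq_big_seq => a ha.
rewrite gen_bracket_skew (hx _ ha) (hy _ hb) scalerN !scalerA.
by rewrite [_ * (-1) ^+ _]mulrC [x@_a * _]mulrC.
Qed.

Lemma twist_gen (k : gen) : twist << k >> = gen_twist k *: << k >>.
Proof. by rewrite /twist msuppU oner_eq0 big_seq_fset1 mcoeffUU mul1r. Qed.

End HeisenbergVirasoro.

(* Main.v *)
Require Import Defs.
From mathcomp Require Import all_boot all_order all_algebra.
From mathcomp Require Import reals.
From mathcomp.real_closed Require Import complex.
From mathcomp.multinomials Require Import monalg.
From HB Require Import structures.
From mathcomp Require Import finmap ring.

Import GRing.Theory.
Local Open Scope ring_scope.
Local Open Scope complex_scope.

(** The element [L_0] acts diagonally: it multiplies a vector of weight [d] by
    [- {d}], where [L_n] and [I_n] have weight [n] while [G_n] and [T_n] have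
    weight [n + 1], and on weight [d] the twist is multiplication by
    [1 + q^d].  For a derivation [phi] of degree [s], the Leibniz rule for
    [L_0] and a vector [x] of weight [d] therefore reads
      [(2 {d + s} - (1 + q^s) {d}) phi(x) = (1 + q^d) [phi(L_0), x]],
    and the coefficient on the left equals [(1 + q^d) {s}].  When
    [1 + q^d] is nonzero this forces [phi(x) = ad_u(x)] with
    [u = phi(L_0) / {s}], an element of the span of [L_s] and [I_s].

    If [q] is a root of unity, some weights may have [q^d = -1]; there the
    twist vanishes and [L_0] gives no information.  The difference
    [psi = phi - ad_u] is again a derivation of degree [s] and kills [L_0],
    hence kills every weight with [q^d <> -1].  For [x] of weight [d] with
    [q^d = -1], the vector [[L_s, x]] has weight [d + s], and
    [q^(d + s) = - q^s <> -1] as [{s} <> 0], so [psi] kills it.  The Leibniz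
    rule for [L_s] and [x], where [x] has zero twist, reduces to
    [[L_s, psi(x)] = 0], and [ad_(L_s)] is injective on weight [d + s] because
    [{s} <> {d + s}] and [{d + s} <> 0] ([ad_L_inj]); the first of these uses
    that the characteristic is not 2, the second that [1 + q^s] is nonzero.
    Hence [psi = 0] ([even_qder_eq0]) and [phi = ad_u] ([even_qder_ad_ex]).

    Conversely, [ad_u] is a derivation of degree [s] for every [u] in the span
    of [L_s] and [I_s]: this is the Hom-Jacobi identity [ad_hom_leibniz], since
    such a [u] is an eigenvector of the twist for [1 + q^s]. *)

Section Derivations.

Variables (F : fieldType) (q : F).

Implicit Types (x y u : hva F) (a b c k : gen) (p r : bool) (m n s : int).

(** * Linear extension from the basis *)

Lemma malg_linear_ext (V : lmodType F) (f g : {linear hva F -> V}) :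
  (forall k, f << k >> = g << k >>) -> f =1 g.
Proof.
move=> fg x; rewrite [x]monalgE !linear_sum; apply: eq_bigr => k _.
have -> : << x@_k *g k >> = x@_k *: << k >>.
  by apply/malgP => k'; rewrite mcoeffZ !mcoeffU mulr_natr.
by rewrite !linearZ fg.
Qed.

Lemma linear_bracketl (l : F) x1 x2 y :
  bracket q (l *: x1 + x2) y = l *: bracket q x1 y + bracket q x2 y.
Proof.
set z := l *: x1 + x2.
set X := (msupp z `|` (msupp x1 `|` msupp x2))%fset.
have sz : (msupp z `<=` X)%fset by exact: fsubsetUl.
have s1 : (msupp x1 `<=` X)%fset by rewrite /X fsetUCA fsubsetUl.
have s2 : (msupp x2 `<=` X)%fset by rewrite /X fsetUA fsubsetUr.
rewrite (bracketw q sz (fsubset_refl (msupp y))).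
rewrite (bracketw q s1 (fsubset_refl (msupp y))).
rewrite (bracketw q s2 (fsubset_refl (msupp y))).
rewrite scaler_sumr -big_split; apply: eq_bigr => a _.
rewrite scaler_sumr -big_split; apply: eq_bigr => b _ /=.
by rewrite mcoeffD mcoeffZ scalerA -scalerDl mulrA -mulrDl.
Qed.

Lemma linear_bracketr (l : F) x y1 y2 :
  bracket q x (l *: y1 + y2) = l *: bracket q x y1 + bracket q x y2.
Proof.
set z := l *: y1 + y2.
set Y := (msupp z `|` (msupp y1 `|` msupp y2))%fset.
have sz : (msupp z `<=` Y)%fset by exact: fsubsetUl.
have s1 : (msupp y1 `<=` Y)%fset by rewrite /Y fsetUCA fsubsetUl.
have s2 : (msupp y2 `<=` Y)%fset by rewrite /Y fsetUA fsubsetUr.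
rewrite (bracketw q (fsubset_refl (msupp x)) sz).
rewrite (bracketw q (fsubset_refl (msupp x)) s1).
rewrite (bracketw q (fsubset_refl (msupp x)) s2).
rewrite scaler_sumr -big_split; apply: eq_bigr => a _.
rewrite scaler_sumr -big_split; apply: eq_bigr => b _ /=.
by rewrite mcoeffD mcoeffZ scalerA -scalerDl mulrDr mulrCA.
Qed.

Lemma linear_twist (l : F) x1 x2 :
  twist q (l *: x1 + x2) = l *: twist q x1 + twist q x2.
Proof.
apply/malgP => k; rewrite mcoeffD mcoeffZ.
have h z : (twist q z)@_k = z@_k * gen_twist q k.
  rewrite /twist raddf_sum /=.
  have [kz|kz] := boolP (k \in msupp z).
    rewrite (big_fsetD1 k) //= mcoeffZ mcoeffUU mulr1.
    rewrite big1_fset ?addr0 // => j; rewrite !inE => /andP[jk _] _.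
    by rewrite mcoeffZ mcoeffU (negbTE jk) mulr0.
  rewrite (mcoeff_outdom kz) mul0r big1_fset // => j jz _.
  rewrite mcoeffZ mcoeffU; case: eqP => [jk|_]; last by rewrite mulr0.
  by rewrite -jk jz in kz.
by rewrite !h mcoeffD mcoeffZ mulrDl mulrA.
Qed.

(** Needed as a named function to carry a linear structure in the left
    argument. *)
Definition bracketr y x := bracket q x y.

HB.instance Definition _ x :=
  GRing.isLinear.Build F (hva F) (hva F) *:%R (bracket q x)
    (fun l => linear_bracketr l x).
HB.instance Definition _ x :=
  GRing.isLinear.Build F (hva F) (hva F) *:%R (ad q x)
    (fun l => linear_bracketr l x).
HB.instance Definition _ y :=
  GRing.isLinear.Build F (hva F) (hva F) *:%R (bracketr y)
    (fun l x1 x2 => linear_bracketl l x1 x2 y).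
HB.instance Definition _ :=
  GRing.isLinear.Build F (hva F) (hva F) *:%R (twist q) linear_twist.

Lemma bracketDl x1 x2 y :
  bracket q (x1 + x2) y = bracket q x1 y + bracket q x2 y.
Proof. exact: (linearD (bracketr y)). Qed.

Lemma bracketDr x y1 y2 :
  bracket q x (y1 + y2) = bracket q x y1 + bracket q x y2.
Proof. exact: (linearD (bracket q x)). Qed.

Lemma bracketZl (l : F) x y : bracket q (l *: x) y = l *: bracket q x y.
Proof. exact: (linearZ_LR (bracketr y)). Qed.

Lemma bracketZr (l : F) x y : bracket q x (l *: y) = l *: bracket q x y.
Proof. exact: (linearZ_LR (bracket q x)). Qed.

Lemma twistD x y : twist q (x + y) = twist q x + twist q y.
Proof. exact: (linearD (twist q)). Qed.

Lemma twistZ (l : F) x : twist q (l *: x) = l *: twist q x.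
Proof. exact: (linearZ_LR (twist q)). Qed.

Lemma bracketNl x y : bracket q (- x) y = - bracket q x y.
Proof. exact: (linearN (bracketr y)). Qed.

Lemma bracketNr x y : bracket q x (- y) = - bracket q x y.
Proof. exact: (linearN (bracket q x)). Qed.

Lemma bracket0l y : bracket q 0 y = 0.
Proof. exact: (linear0 (bracketr y)). Qed.

Lemma ad_comb (c d : F) u v x :
  ad q (c *: u + d *: v) x = c *: ad q u x + d *: ad q v x.
Proof. by rewrite /ad bracketDl !bracketZl. Qed.

(** * Parity *)

Lemma homogP p x : homog p x <-> forall k, gpar k != p -> x@_k = 0.
Proof.
split=> h k; last first.
  by rewrite -mcoeff_neq0; apply: contraNeq => /h ->.
by move=> kp; apply: mcoeff_outdom; apply: contra kp => /h ->.
Qed.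

Lemma homog0 p : homog p (0 : hva F).
Proof. by apply/homogP => k _; rewrite mcoeff0. Qed.

Lemma homogD p x y : homog p x -> homog p y -> homog p (x + y).
Proof.
move=> /homogP hx /homogP hy; apply/homogP => k kp.
by rewrite mcoeffD hx // hy // addr0.
Qed.

Lemma homogZ p (l : F) x : homog p x -> homog p (l *: x).
Proof.
by move=> /homogP hx; apply/homogP => k kp; rewrite mcoeffZ hx // mulr0.
Qed.

Lemma homogN p x : homog p x -> homog p (- x).
Proof. by move=> hx; rewrite -scaleN1r; apply: homogZ. Qed.

Lemma homog_gen k : homog (gpar k) (<< k >> : hva F).
Proof.
apply/homogP => k'; rewrite mcoeffU.
by have [->|//] := eqVneq k k'; rewrite eqxx.
Qed.

Lemma homog_gen_bracket a b : homog (gpar a (+) gpar b) (gen_bracket q a b).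
Proof.
case: a b => [m|m|m|m] [n|n|n|n] /=; rewrite ?opprK;
  do ?[exact: homog0 | apply: homogN | apply: homogZ];
  exact: homog_gen.
Qed.

Lemma homog_bracket p r x y :
  homog p x -> homog r y -> homog (p (+) r) (bracket q x y).
Proof.
move=> hx hy; apply/homogP => k kpr; rewrite /bracket raddf_sum big1_seq //.
move=> a /andP[_ ax]; rewrite raddf_sum big1_seq // => b /andP[_ yb] /=.
have /homogP h := homogZ _ (x@_a * y@_b) _ (homog_gen_bracket a b).
by rewrite h // (hx _ ax) (hy _ yb).
Qed.

(** * The Hom-Jacobi identity *)

(** The label of the basis vector to which [[a, b]] is proportional.  Reading
    the types L, I, G, T as the pairs of bits of [gen_code], the types combine by
    bitwise disjunction, which makes this product associative and commutative
    even where the bracket vanishes; the three terms of the Hom-Jacobi identity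
    are then multiples of one basis vector. *)
Definition gprod a b : gen :=
  let: (pa, ia, na) := gen_code a in
  let: (pb, ib, nb) := gen_code b in
  gen_decode (pa || pb, ia || ib, na + nb).

Definition gcoef a b : F :=
  match a, b with
  | gL m, gL n => qint q m - qint q n
  | gL m, gI n => - qint q n
  | gI m, gL n => qint q m
  | gL m, gG n => qint q m - qint q (n + 1)
  | gG m, gL n => qint q (m + 1) - qint q n
  | gI m, gG n => qint q m
  | gG m, gI n => - qint q n
  | gL m, gT n => - qint q (n + 1)
  | gT m, gL n => qint q (m + 1)
  | _, _ => 0
  end.

Lemma gprodC : commutative gprod.
Proof. by move=> [m|m|m|m] [n|n|n|n]; rewrite /gprod /= addrC. Qed.

Lemma gprodA : associative gprod.
Proof.
by move=> [l|l|l|l] [m|m|m|m] [n|n|n|n]; rewrite /gprod /= addrA.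
Qed.

Lemma gen_bracketE a b : gen_bracket q a b = gcoef a b *: << gprod a b >>.
Proof.
case: a b => [m|m|m|m] [n|n|n|n]; rewrite /gprod /= ?scale0r //;
  by rewrite [n + m]addrC -?scaleNr ?opprK ?opprB.
Qed.

(** All terms are multiples of the vector [gprod a (gprod b c)], so the identity
    reduces to one between structure constants, polynomial in the powers of [q].
    The evenness of [a] removes all signs. *)
Lemma gen_hom_leibniz a b c : q != 0 -> gpar a = false ->
  gen_twist q a *: bracket q << a >> (gen_bracket q b c) =
    gen_twist q c *: bracket q (gen_bracket q a b) << c >> +
    gen_twist q b *: bracket q << b >> (gen_bracket q a c).
Proof.
move=> q0 ea; rewrite !gen_bracketE !bracketZr bracketZl !bracket_gen.
rewrite !gen_bracketE !scalerA gprodA [gprod b (gprod a c)]gprodA.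
rewrite [gprod b a]gprodC -scalerDl; congr (_ *: _).
by case: a b c ea => [l|l|l|l] [m|m|m|m] [n|n|n|n] //= _;
  rewrite /qint ?(expfzDr _ _ q0); ring.
Qed.

Lemma scale_eq_comb (V : lmodType F) (t c d : F) (v w v1 v2 w1 w2 : V) :
  t *: v = v1 + v2 -> t *: w = w1 + w2 ->
  t *: (c *: v + d *: w) = (c *: v1 + d *: w1) + (c *: v2 + d *: w2).
Proof.
move=> tv tw; rewrite scalerDr !scalerA ![t * _]mulrC -!scalerA tv tw.
by rewrite !scalerDr addrACA.
Qed.

(** Both [L_s] and [I_s] are eigenvectors of the twist for the same eigenvalue,
    so the identity on basis vectors extends to their combinations. *)
Lemma ad_hom_leibniz s u x y : q != 0 -> in_span2 (bL F s) (bI F s) u ->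
  (1 + q ^ s) *: bracket q u (bracket q x y) =
    bracket q (bracket q u x) (twist q y) +
    bracket q (twist q x) (bracket q u y).
Proof.
move=> q0 [c [d ->]]; move: x y.
suff gen_u a x y : gpar a = false ->
    gen_twist q a *: bracket q << a >> (bracket q x y) =
      bracket q (bracket q << a >> x) (twist q y) +
      bracket q (twist q x) (bracket q << a >> y).
  move=> x y; rewrite !(bracketDl, bracketZl, bracketDr, bracketZr).
  exact: scale_eq_comb (gen_u (gL s) x y erefl) (gen_u (gI s) x y erefl).
move=> ea.
(* Extension from basis vectors, in x and then in y. *)
pose f := gen_twist q a \*: (bracket q << a >> \o bracketr y).
pose g := (bracketr (twist q y) \o bracket q << a >>) \+
          (bracketr (bracket q << a >> y) \o twist q).
apply: (malg_linear_ext _ f g) => b; rewrite /f /g /= /bracketr.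
pose f' := gen_twist q a \*: (bracket q << a >> \o bracket q << b >>).
pose g' := (bracket q (bracket q << a >> << b >>) \o twist q) \+
           (bracket q (twist q << b >>) \o bracket q << a >>).
apply: (malg_linear_ext _ f' g') => c'; rewrite /f' /g' /=.
by rewrite !twist_gen !bracket_gen bracketZr bracketZl gen_hom_leibniz.
Qed.

(** * Homogeneous components *)

(** The shift by one in odd degree is the one of the action of [L_0] and of the
    twist; with it, even and odd vectors obey the same formulas. *)
Definition wt p n : int := if p then n + 1 else n.
Definition ghd p n : gen := if p then gG n else gL n.
Definition gtl p n : gen := if p then gT n else gI n.
Definition comp p n x : Prop := in_span2 << ghd p n >> << gtl p n >> x.

Lemma wtD p m n : wt p (n + m) = wt p n + m.
Proof. by case: p; rewrite /wt // addrAC. Qed.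

Lemma gen_comp k : exists p n, comp p n << k >>.
Proof.
case: k => n; [exists false | exists false | exists true | exists true];
  exists n; [exists 1, 0 | exists 0, 1 | exists 1, 0 | exists 0, 1];
  by rewrite scale1r scale0r ?addr0 ?add0r.
Qed.

Lemma twist_comp p n x : comp p n x -> twist q x = (1 + q ^ wt p n) *: x.
Proof.
have twist_monom (l : F) k :
    twist q (l *: << k >>) = gen_twist q k *: (l *: << k >> : hva F).
  by rewrite twistZ twist_gen !scalerA mulrC.
case=> c [d ->]; rewrite twistD !twist_monom.
have -> : gen_twist q (ghd p n) = 1 + q ^ wt p n by case: p.
have -> : gen_twist q (gtl p n) = 1 + q ^ wt p n by case: p.
by rewrite -scalerDr.
Qed.

Lemma bracket_L_comp m p n (c d : F) :
  bracket q (bL F m) (c *: << ghd p n >> + d *: << gtl p n >>) =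
    (c * (qint q m - qint q (wt p n))) *: << ghd p (m + n) >> +
    (d * - qint q (wt p n)) *: << gtl p (m + n) >>.
Proof. by rewrite bracketDr !bracketZr !bracket_gen -!scalerA; case: p. Qed.

Lemma bracket_I_comp m p n (c d : F) :
  bracket q (bI F m) (c *: << ghd p n >> + d *: << gtl p n >>) =
    (c * qint q m) *: << gtl p (m + n) >>.
Proof.
have hd_E : gen_bracket q (gI m) (ghd p n) = qint q m *: << gtl p (m + n) >>.
  by rewrite gen_bracketE; case: p.
have tl_E : gen_bracket q (gI m) (gtl p n) = 0 by case: p {hd_E}.
by rewrite bracketDr !bracketZr !bracket_gen hd_E tl_E scaler0 addr0 scalerA.
Qed.

Lemma bracket_L0_comp p n x :
  comp p n x -> bracket q (bL F 0) x = - qint q (wt p n) *: x.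
Proof.
case=> c [d ->]; rewrite bracket_L_comp add0r.
rewrite [qint q 0]/qint expr0z subrr mul0r.
by rewrite sub0r scalerDr !scalerA ![_ * - qint _ _]mulrC.
Qed.

Lemma ad_comp s p n u x : in_span2 (bL F s) (bI F s) u ->
  comp p n x -> comp p (n + s) (bracket q u x).
Proof.
move=> [c [d ->]] [c' [d' ->]]; rewrite bracketDl !bracketZl.
rewrite bracket_L_comp bracket_I_comp [s + n]addrC scalerDr !scalerA -addrA.
by rewrite -scalerDl; do 2!eexists.
Qed.

(** The matrix of [ad_(L_s)] on a component is diagonal, with entries
    [{s} - {d}] and [- {d}] where [d] is the weight. *)
Lemma ad_L_inj s p n x : comp p n x ->
  qint q s != qint q (wt p n) -> qint q (wt p n) != 0 ->
  bracket q (bL F s) x = 0 -> x = 0.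
Proof.
case=> c [d ->] sn n0; rewrite bracket_L_comp => /malgP h.
have htl : ghd p (s + n) != gtl p (s + n) by case: p {h sn n0}.
have := h (ghd p (s + n)); have := h (gtl p (s + n)).
rewrite !mcoeff0 !mcoeffD !mcoeffZ !mcoeffU !eqxx (negbTE htl).
rewrite [gtl _ _ == _]eq_sym (negbTE htl) !mulr0 !mulr1 addr0 add0r.
move/eqP; rewrite mulf_eq0 oppr_eq0 (negbTE n0) orbF => /eqP ->.
move/eqP; rewrite mulf_eq0 subr_eq0 (negbTE sn) orbF => /eqP ->.
by rewrite !scale0r addr0.
Qed.

Lemma comp_homog p n x : comp p n x -> homog p x.
Proof.
by case=> c [d ->]; apply: homogD; apply: homogZ; case: p; apply: homog_gen.
Qed.

Lemma qder_comp s (phi : {linear hva F -> hva F}) p n x :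
  even_qder q s phi -> comp p n x -> comp p (n + s) (phi x).
Proof.
move=> Dphi; case: p.
  exact: (even_qder_deg1 Dphi).
exact: (even_qder_deg0 Dphi).
Qed.

(** * Even derivations of a given degree *)

Lemma even_qder_ad s u : q != 0 -> 1 + q ^ s != 0 ->
  in_span2 (bL F s) (bI F s) u -> even_qder q s (ad q u).
Proof.
move=> q0 qs0 hu; split.
- move=> p x; apply: (homog_bracket false).
  by apply: (comp_homog _ s).
- by move=> n x; apply: (ad_comp s false n u x hu).
- by move=> n x; apply: (ad_comp s true n u x hu).
- move=> p r x y _ _ /=; have := ad_hom_leibniz s u x y q0 hu.
  by rewrite /ad => <-; rewrite scalerA mulVf // scale1r.
Qed.

Lemma eq_even_qder s (phi psi : {linear hva F -> hva F}) :
  phi =1 psi -> even_qder q s psi -> even_qder q s phi.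
Proof.
move=> eq_phi [h1 h2 h3 h4]; split.
- by move=> p x; rewrite eq_phi; apply: h1.
- by move=> n x; rewrite eq_phi; apply: h2.
- by move=> n x; rewrite eq_phi; apply: h3.
- by move=> p r x y hx hy; rewrite !eq_phi (h4 p r).
Qed.

Lemma in_span2B (v1 v2 x y : hva F) :
  in_span2 v1 v2 x -> in_span2 v1 v2 y -> in_span2 v1 v2 (x - y).
Proof.
move=> [c [d ->]] [c' [d' ->]]; exists (c - c'), (d - d').
by rewrite !scalerBl opprD addrACA.
Qed.

Lemma even_qderB s (phi psi : {linear hva F -> hva F}) :
  even_qder q s phi -> even_qder q s psi -> even_qder q s (phi \- psi).
Proof.
move=> [h1 h2 h3 h4] [h1' h2' h3' h4']; split.
- move=> p x hx /=; apply: homogD; first exact: h1.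
  by apply: homogN; apply: h1'.
- by move=> n x hx /=; apply: in_span2B; [apply: h2 | apply: h2'].
- by move=> n x hx /=; apply: in_span2B; [apply: h3 | apply: h3'].
- move=> p r x y hx hy /=; rewrite (h4 p r) // (h4' p r) // -scalerBr.
  by rewrite bracketDl bracketNl bracketDr bracketNr opprD addrACA.
Qed.

(** A derivation that kills [L_0] kills every weight [d] with [q^d <> -1], by
    the Leibniz rule for [L_0].  The remaining weights are reached from these by
    bracketing with [L_s], whose twist does not vanish. *)
Lemma even_qder_eq0 s (psi : {linear hva F -> hva F}) :
  q != 0 -> q != 1 -> 2%:R != 0 :> F -> 1 + q ^ s != 0 -> qint q s != 0 ->
  even_qder q s psi -> psi (bL F 0) = 0 -> forall x, psi x = 0.
Proof.
move=> q0 q1 two0 qs0 s0 Dpsi psiL0.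
have q1' : 1 - q != 0 by rewrite subr_eq0 eq_sym.
have L_comp m : comp false m (bL F m).
  by exists 1, 0; rewrite scale1r scale0r addr0.
have leib x y p n m r : comp p n x -> comp r m y ->
    (1 + q ^ s) *: psi (bracket q x y) =
      bracket q (psi x) (twist q y) + bracket q (twist q x) (psi y).
  move=> hx hy; rewrite (even_qder_leibniz Dpsi (comp_homog _ _ _ hx)
    (comp_homog _ _ _ hy)).
  by rewrite scalerA mulfV // scale1r.
have psi0 p n x : comp p n x -> 1 + q ^ wt p n != 0 -> psi x = 0.
  move=> hx n0; have := leib _ _ _ _ _ _ (L_comp 0) hx.
  rewrite psiL0 bracket0l add0r (bracket_L0_comp _ _ _ hx) linearZ /=.
  rewrite (twist_comp _ _ _ (L_comp 0)) bracketZl expr0z.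
  rewrite (bracket_L0_comp _ _ _ (qder_comp _ _ _ _ _ Dpsi hx)) wtD.
  rewrite !scalerA => /eqP; rewrite -subr_eq0 -scalerBl scaler_eq0.
  case/orP=> [/eqP h|/eqP //]; case/negP: (mulf_neq0 n0 s0); apply/eqP.
  (* The identity 2 {d + s} - (1 + q^s) {d} = (1 + q^d) {s}. *)
  by rewrite -h /qint expfzDr //; ring.
have psi_comp p n x : comp p n x -> psi x = 0.
  (* Where the twist of x vanishes, the Leibniz rule for L_s applies. *)
  move=> hx; have [h|] := eqVneq (1 + q ^ wt p n) 0; last exact: psi0.
  have qn : q ^ wt p n = -1 by apply/eqP; rewrite -addr_eq0 addrC h.
  have Ls : in_span2 (bL F s) (bI F s) (bL F s).
    by exists 1, 0; rewrite scale1r scale0r addr0.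
  have qns : q ^ wt p (n + s) = - q ^ s by rewrite wtD expfzDr // qn mulN1r.
  have qs1 : 1 - q ^ s != 0.
    by apply: contraNneq s0 => h'; rewrite /qint h' mul0r.
  have hLx := ad_comp _ _ _ _ _ Ls hx.
  have := leib _ _ _ _ _ _ (L_comp s) hx.
  rewrite (psi0 _ _ _ hLx) ?qns // scaler0 (twist_comp _ _ _ hx) h scale0r.
  rewrite linear0 add0r (twist_comp _ _ _ (L_comp s)) bracketZl => /esym/eqP.
  rewrite scaler_eq0 (negbTE qs0) /= => /eqP.
  apply: (ad_L_inj _ _ _ _ (qder_comp _ _ _ _ _ Dpsi hx)).
    rewrite /qint qns -subr_eq0 -mulrBl mulf_neq0 ?invr_eq0 //.
    have -> : 1 - q ^ s - (1 - - q ^ s) = - (2%:R * q ^ s) by ring.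
    by rewrite oppr_eq0 mulf_neq0 // expfz_neq0.
  by rewrite /qint qns opprK mulf_neq0 ?invr_eq0.
move=> x; apply: (malg_linear_ext _ psi \0) => k /=.
by have [p [n /psi_comp]] := gen_comp k.
Qed.

(** Since [[L_s, L_0] = {s} L_s] and [[I_s, L_0] = {s} I_s], the element
    [u = phi(L_0) / {s}] is the one for which [ad_u] and [phi] agree on [L_0];
    uniqueness then gives [phi = ad_u]. *)
Lemma even_qder_ad_ex s (phi : {linear hva F -> hva F}) :
  q != 0 -> q != 1 -> 2%:R != 0 :> F -> 1 + q ^ s != 0 -> qint q s != 0 ->
  even_qder q s phi ->
  exists2 u, in_span2 (bL F s) (bI F s) u & phi =1 ad q u.
Proof.
move=> q0 q1 two0 qs0 s0 Dphi.
have L0 : in_span2 (bL F 0) (bI F 0) (bL F 0).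
  by exists 1, 0; rewrite scale1r scale0r addr0.
have := even_qder_deg0 Dphi L0; rewrite add0r => -[c [d phiL0]].
pose u := ((qint q s)^-1 * c) *: bL F s + ((qint q s)^-1 * d) *: bI F s.
have hu : in_span2 (bL F s) (bI F s) u.
  by exists ((qint q s)^-1 * c), ((qint q s)^-1 * d).
have Dpsi : even_qder q s (phi \- ad q u) :=
  even_qderB s phi (ad q u) Dphi (even_qder_ad s u q0 qs0 hu).
exists u => // x; apply/eqP; rewrite -subr_eq0; apply/eqP.
apply: (even_qder_eq0 s _ q0 q1 two0 qs0 s0 Dpsi).
rewrite /= phiL0 /ad /u bracketDl !bracketZl !bracket_gen /= addr0 add0r.
rewrite [qint q 0]/qint expr0z subrr mul0r subr0 scaleNr opprK !scalerA.
by rewrite ![_^-1 * _]mulrC !mulfVK // subrr.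
Qed.

End Derivations.

Theorem proposition3p5 (R : realType) (q : R[i]) (s : int)
    (q_neq0 : q != 0) (q_neq1 : q != 1) (s_neq0 : s != 0)
    (qs_defined : 1 + q ^ s != 0) (qs_neq0 : qint q s != 0) :
  (forall phi : {linear hva R[i] -> hva R[i]},
     even_qder q s phi -> inner_qder q phi) /\
  (forall phi : {linear hva R[i] -> hva R[i]},
     even_qder q s phi <->
     exists c d : R[i], forall x : hva R[i],
       phi x = c *: ad q (bL _ s) x + d *: ad q (bI _ s) x).
Proof.
have two_neq0 : 2%:R != 0 :> R[i] by rewrite Num.Theory.pnatr_eq0.
have inner phi := even_qder_ad_ex R[i] q s phi q_neq0 q_neq1 two_neq0
  qs_defined qs_neq0.
split=> phi; [|split].
- move=> /inner[u hu phiE]; exists false, u; split=> //.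
  exact: (comp_homog _ false s).
- move=> /inner[u [c [d ->]] phiE]; exists c, d => x.
  by rewrite phiE; apply: ad_comb.
- move=> [c [d phiE]]; pose u := c *: bL _ s + d *: bI _ s.
  apply: (eq_even_qder _ _ _ _ (ad q u)).
    by move=> x; rewrite phiE; symmetry; apply: ad_comb.
  by apply: even_qder_ad => //; exists c, d.
Qed.
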